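(* Let $\beta>0$, $n\ge1$, $\ell\ge1$, $z_1,\dots,z_\ell\in\mathbb C$, and $w_1,\dots,w_\ell\in\mathbb C\setminus\mathbb R$. Then $$E\prod_{j=1}^\ell\frac{p_n(e^{iz_j/n})e^{-iz_j/2}}{p_n(e^{iw_j/n})e^{-iw_j/2}}=\begin{cases}e^{\,i\sum_{j=1}^\ell\frac{z_j-w_j}{2}}&\text{if }\Im w_j<0\text{ for all }1\le j\le\ell,\\ e^{-i\sum_{j=1}^\ell\frac{z_j-w_j}{2}}&\text{if }\Im w_j>0\text{ for all }1\le j\le\ell.\end{cases}$$
   Context: The size-$n$ circular $\beta$-ensemble is a random vector $(z_1,\dots,z_n)$ of unit complex numbers with joint density proportional to $\prod_{1\le j<k\le n}|z_j-z_k|^\beta$ on $\{|z|=1\}^n$, and $p_n(z)=\prod_{j=1}^n\frac{z-z_j}{1-z_j}$ is its normalized characteristic polynomial. *)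

(* Defs.v *)
From HB Require Import structures.
From mathcomp Require Import all_boot all_order all_algebra.
From mathcomp Require Import all_classical all_reals all_analysis.
From mathcomp Require Import complex.
Set Implicit Arguments. Unset Strict Implicit. Unset Printing Implicit Defensive.
Import Order.TTheory GRing.Theory Num.Theory.
Local Open Scope ring_scope.
Local Open Scope classical_set_scope.

Section CBE.
Variable R : realType.

Definition cexp (z : R[i]) : R[i] :=
  (expR (complex.Re z))%:C%C * ((cos (complex.Im z)) +i* (sin (complex.Im z)))%C.

Definition eit (t : R) : R[i] := (cos t +i* sin t)%C.

Definition cmod (z : R[i]) : R :=
  Num.sqrt (complex.Re z ^+ 2 + complex.Im z ^+ 2).

Definition pn (zs : seq R[i]) (z : R[i]) : R[i] :=
  \prod_(zj <- zs) ((z - zj) / (1 - zj)).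

Fixpoint tint (n : nat) (f : seq R -> R) : R :=
  match n with
  | 0 => f [::]
  | k.+1 => Rintegral (@lebesgue_measure R) `[0, 2 * pi]%classic
              (fun t => tint k (fun s => f (t :: s)))
  end.

Definition ctint (n : nat) (f : seq R -> R[i]) : R[i] :=
  (tint n (fun s => complex.Re (f s)) +i* tint n (fun s => complex.Im (f s)))%C.

Definition cbe_density (beta : R) (th : seq R) : R :=
  \prod_(j < size th) \prod_(k < size th | (j < k)%N)
     (cmod (eit (nth 0 th j) - eit (nth 0 th k))) `^ beta.

Definition cbe_E (n : nat) (beta : R) (F : seq R[i] -> R[i]) : R[i] :=
  ctint n (fun th => F (map eit th) * (cbe_density beta th)%:C%C)
  / (tint n (cbe_density beta))%:C%C.

End CBE.

(* Main.v *)
Require Import Defs.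
From HB Require Import structures.
From mathcomp Require Import all_boot all_order all_algebra.
From mathcomp Require Import all_classical all_reals all_analysis.
From mathcomp Require Import complex ring lra zify.
Import Order.TTheory GRing.Theory Num.Theory numFieldNormedType.Exports.
Import ComplexField.Normc.
Local Open Scope ring_scope.

Set Implicit Arguments. Unset Strict Implicit. Unset Printing Implicit Defensive.

(** After cancelling the normalizations 1 - z_j, the integrand is a constant
    times prod_k G(u_k), where G(u) = prod_j (Z_j - u) / (W_j - u),
    Z_j = e^{i z_j/n}, W_j = e^{i w_j/n}.  If Im w_j < 0 then |W_j| > 1, so that
    G is on the unit circle a uniform limit of polynomials P with P(0) = G(0).
    For a polynomial P, rotation invariance of the ensemble allows one to replace
    prod_k P(u_k) by its average over the rotations by the N-th roots of unity;
    for large N this average is identically P(0)^n.  Hence E prod_k G(u_k) =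
    G(0)^n = prod_j (Z_j / W_j)^n.  If Im w_j > 0 then |W_j| < 1, and since
    1/u is the conjugate of u on the circle, the conjugate of G is there
    prod_j (1 - conj Z_j u) / (1 - conj W_j u), to which the same argument
    applies with the value 1 at 0. *)

(** * Integrals of continuous functions on a segment *)

Lemma continuous_integrable_itv (R : realType) (H : R -> R) (a b : R) :
  continuous H ->
  (@lebesgue_measure R).-integrable `[a, b]%classic (EFin \o H).
Proof.
move=> cH; apply: continuous_compact_integrable; first exact: segment_compact.
exact: continuous_subspaceT.
Qed.

Lemma Rintegral_abs_le (R : realType) (H : R -> R) (a b C : R) : a <= b ->
  continuous H -> (forall x, `|H x| <= C) ->
  `|Rintegral (@lebesgue_measure R) `[a, b]%classic H| <= (b - a) * C.
Proof.
move=> ab cH HC; apply: le_trans (le_normr_Rintegral _ _) _ => //.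
  exact: continuous_integrable_itv.
apply: le_trans (le_Rintegral (f2 := cst C) _ _ _ _) _ => //.
- apply: (continuous_integrable_itv (H := fun x => `|H x|)) => x.
  by apply: continuous_comp; [exact: cH|exact: norm_continuous].
- by apply: continuous_integrable_itv => x; exact: cvg_cst.
- by rewrite Rintegral_cst//= lebesgue_measure_itv/= lte_fin; case: ltP => ?;
    rewrite ?mulr0 ?mulr_ge0 ?subr_ge0 ?(le_trans _ (HC 0))//= mulrC.
Qed.

(** By continuity [H] exceeds [H x / 2] on a short segment around [x] inside [a, b]; since [H] is
    nonnegative, the integral over that segment is a lower bound. *)
Lemma Rintegral_gt0 (R : realType) (H : R -> R) (a b x : R) :
  continuous H -> (forall x, 0 <= H x) -> a < x < b -> 0 < H x ->
  0 < Rintegral (@lebesgue_measure R) `[a, b]%classic H.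
Proof.
move=> cH H0 /andP[ax xb] Hx.
have /cvgrPdist_lt/(_ (H x / 2))[|d /= d0 dP] := cH x; first by rewrite divr_gt0.
(* Halving [d] keeps the closed segment of radius [r] inside the open ball of radius [d]; the other
   two bounds keep it inside [a, b]. *)
pose r := Num.min (d / 2) (Num.min (x - a) (b - x)).
have r0 : 0 < r by rewrite !lt_min !subr_gt0 ax xb divr_gt0.
have rd : r < d by rewrite gt_min; apply/orP; left; lra.
have ra : r <= x - a by rewrite !ge_min lexx !orbT.
have rb : r <= b - x by rewrite !ge_min lexx !orbT.
have sub : (`[x - r, x + r] `<=` `[a, b])%classic.
  by move=> y /=; rewrite !in_itv/= => /andP[? ?]; apply/andP; split; lra.
apply: (@lt_le_trans _ _ (Rintegral (@lebesgue_measure R) `[x - r, x + r]%classic H)).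
  apply: (@lt_le_trans _ _ (Rintegral (@lebesgue_measure R) `[x - r, x + r]%classic
    (cst (H x / 2)))).
    rewrite Rintegral_cst//= lebesgue_measure_itv/= lte_fin ifT; last lra.
    by rewrite mulr_gt0 ?divr_gt0//=; lra.
  apply: le_Rintegral => //.
  - by apply: continuous_integrable_itv => y; exact: cvg_cst.
  - exact: continuous_integrable_itv.
  - move=> y /=; rewrite in_itv/= => /andP[? ?].
    have : `|H x - H y| < H x / 2.
      by apply: dP => /=; rewrite ltr_norml; apply/andP; split; lra.
    by rewrite ltr_norml => /andP[_]; lra.
have -> : Rintegral (@lebesgue_measure R) `[x - r, x + r]%classic H =
   Rintegral (@lebesgue_measure R) `[a, b]%classic (H \_ `[x - r, x + r])%classic.
  by rewrite -Rintegral_mkcondr; congr Rintegral; rewrite setIidr.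
apply: le_Rintegral => //.
- rewrite -restrict_EFin; apply/integrable_restrict => //=.
  by rewrite setIidr//; exact: continuous_integrable_itv.
- exact: continuous_integrable_itv.
- by move=> y _; rewrite /patch; case: ifP.
Qed.

(* The primitive K of H satisfies K' (x + T) = K' (x), so K (x + T) - K x does
   not depend on x. *)
Lemma Rintegral_periodic_shift (R : realType) (H : R -> R) (T c : R) :
  0 < T -> continuous H -> (forall x, H (x + T) = H x) ->
  Rintegral (@lebesgue_measure R) `[0, T]%classic (fun x => H (x + c)) =
  Rintegral (@lebesgue_measure R) `[0, T]%classic H.
Proof.
move=> T0 cH perH.
(* Adding to [c] a multiple of [T] larger than |c| does not change the shifted function and makes
   the shift nonnegative. *)
wlog c0 : c / 0 <= c.
  move=> main; pose k := Num.Def.archi_bound (`|c| / T).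
  have kP n x : H (x + n%:R * T) = H x.
    elim: n => [|n IHn]; first by rewrite mul0r addr0.
    by rewrite -addn1 natrD mulrDl mul1r addrA perH.
  have -> : (fun x => H (x + c)) = (fun x => H (x + (c + k%:R * T))).
    by apply/funext => x; rewrite addrA kP.
  apply: main; have : `|c| / T < k%:R.
    apply: Num.Theory.archi_boundP.
    apply: divr_ge0 => //; exact: ltW.
  rewrite ltr_pdivrMr// => cT; have := ler_norm (- c); rewrite normrN => ?.
  by lra.
(* Starting the primitive at -1 makes it differentiable at every point of [0, +oo), the end point 0
   included. *)
pose K (x : R) : R := Rintegral (@lebesgue_measure R) `[-1, x]%classic H.
have K' (x : R) : -1 < x -> is_derive x 1 K (H x).
  move=> x1.
  have xx1 : x < x + 1 by lra.
  have [dK K'] := @continuous_FTC1_closed R H (-1) x (x + 1) xx1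
    (continuous_integrable_itv _ _ cH) x1 (cH x).
  by apply: DeriveDef; [exact: dK|rewrite -derive1E; exact: K'].
have shiftK (a y : R) : -1 < y + a -> is_derive y 1 (fun x => K (x + a)) (H (y + a)).
  move=> ya; have Ky := K' _ ya.
  have ida : is_derive y 1 (fun x : R => x + a) 1.
    by apply: is_derive_eq; rewrite addr0.
  have := @is_derive1_comp R K (fun x => x + a) y (H (y + a)) 1 Ky ida.
  by rewrite mulr1.
have FTC (a : R) : 0 <= a -> Rintegral (@lebesgue_measure R) `[0, T]%classic
    (fun x => H (x + a)) = K (T + a) - K a.
  move=> a0; rewrite /Rintegral.
  have cHa : continuous (fun x => H (x + a)).
    move=> y; apply: continuous_comp; last exact: cH.
    by apply: cvgD; [exact: cvg_id|exact: cvg_cst].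
  have cK y : 0 <= y -> {for y, continuous (fun x => K (x + a))}.
    move=> y0; apply: differentiable_continuous; apply/derivable1_diffP.
    have ya : -1 < y + a by lra.
    exact: (@ex_derive _ _ _ _ _ _ _ (shiftK a y ya)).
  rewrite (@continuous_FTC2 R (fun x => H (x + a)) (fun x => K (x + a)) 0 T T0).
  - by rewrite /= add0r.
  - exact: continuous_subspaceT.
  - split=> [y||].
    + rewrite in_itv/= => /andP[y0 _]; have ya : -1 < y + a by lra.
      exact: (@ex_derive _ _ _ _ _ _ _ (shiftK a y ya)).
    + by apply: cvg_at_right_filter; apply: cK.
    + by apply: cvg_at_left_filter; apply: cK; exact: ltW.
  - move=> y; rewrite in_itv/= => /andP[y0 _]; have ya : -1 < y + a by lra.
    by rewrite derive1E; exact: (@derive_val _ _ _ _ _ _ _ (shiftK a y ya)).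
rewrite FTC//.
have -> : H = (fun x => H (x + 0)) by apply/funext => x; rewrite addr0.
rewrite FTC// addr0.
pose D (y : R) : R := K (y + T) - K (y + 0).
have D' (y : R) : 0 <= y -> is_derive y 1 D 0.
  move=> y0; have y1 : -1 < y + T by lra.
  have y2 : -1 < y + 0 by lra.
  have := is_deriveB (shiftK _ _ y1) (shiftK _ _ y2).
  by rewrite perH addr0 subrr.
(* [D] has zero derivative, so the mean value theorem on [0, c] gives [D c = D 0], which is the
   equality of the two integrals. *)
have [||y yP] := @MVT_segment R D (fun=> 0) 0 c c0.
- by move=> y; rewrite in_itv/= => /andP[/ltW y0 _]; exact: D'.
- apply: derivable_within_continuous => y; rewrite in_itv/= => /andP[y0 _].
  exact: (@ex_derive _ _ _ _ _ _ _ (D' y y0)).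
by rewrite mul0r /D !addr0 add0r [c + T]addrC => /eqP; rewrite subr_eq0 => /eqP.
Qed.

(** * Iterated integrals *)

(** Bounded and uniformly continuous on all of R^n rather than on the cube:
    the integrands are periodic in each variable. *)
Definition buc (R : realType) (n : nat) (f : seq R -> R) :=
  (exists C, forall s, size s = n -> `|f s| <= C) /\
  forall e, 0 < e -> exists2 d, 0 < d & forall s t,
    size s = n -> size t = n -> (forall i, `|s`_i - t`_i| <= d) ->
    `|f s - f t| <= e.

Section BoundedUniformlyContinuous.
Context (R : realType) (n : nat).
Implicit Types (f g : seq R -> R) (s t : seq R).

Lemma eq_buc f g : (forall s, size s = n -> f s = g s) -> buc n f -> buc n g.
Proof.
move=> fg [[C fC] fu]; split; first by exists C => s sn; rewrite -fg// fC.
move=> e e0; have [d d0 dP] := fu e e0; exists d => // s t sn tn st.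
by rewrite -!fg// dP.
Qed.

Lemma buc_cst c : buc n (fun=> c : R).
Proof.
split; first by exists `|c|.
by move=> e e0; exists 1 => // s t *; rewrite subrr normr0 ltW.
Qed.

Lemma bucD f g : buc n f -> buc n g -> buc n (fun s => f s + g s).
Proof.
move=> [[C fC] fu] [[D gD] gu]; split.
  exists (C + D) => s sn; apply: le_trans (ler_normD _ _) _.
  by rewrite lerD ?fC ?gD.
move=> e e0; have e20 : 0 < e / 2 by rewrite divr_gt0.
have [d d0 dP] := fu _ e20; have [d' d'0 d'P] := gu _ e20.
exists (Num.min d d'); first by rewrite lt_min d0.
move=> s t sn tn st.
have /dP : forall i, `|s`_i - t`_i| <= d.
  by move=> i; rewrite (le_trans (st i))// ge_min lexx.
have /d'P : forall i, `|s`_i - t`_i| <= d'.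
  by move=> i; rewrite (le_trans (st i))// ge_min lexx orbT.
move=> /(_ sn tn) A /(_ sn tn) B.
have -> : f s + g s - (f t + g t) = (f s - f t) + (g s - g t) by ring.
by apply: le_trans (ler_normD _ _) _; lra.
Qed.

Lemma bucM f g : buc n f -> buc n g -> buc n (fun s => f s * g s).
Proof.
move=> [[C fC] fu] [[D gD] gu].
have {}fC s : size s = n -> `|f s| <= `|C|.
  by move=> sn; rewrite (le_trans (fC s sn))// ler_norm.
have {}gD s : size s = n -> `|g s| <= `|D|.
  by move=> sn; rewrite (le_trans (gD s sn))// ler_norm.
split.
  by exists (`|C| * `|D|) => s sn; rewrite normrM ler_pM ?fC ?gD.
move=> e e0; pose e' := e / (`|C| + `|D| + 1).
have K0 : 0 < `|C| + `|D| + 1 by rewrite ltr_wpDl// addr_ge0.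
have e'0 : 0 < e' by rewrite divr_gt0.
have [d d0 dP] := fu _ e'0; have [d' d'0 d'P] := gu _ e'0.
exists (Num.min d d'); first by rewrite lt_min d0.
move=> s t sn tn st.
have /dP : forall i, `|s`_i - t`_i| <= d.
  by move=> i; rewrite (le_trans (st i))// ge_min lexx.
have /d'P : forall i, `|s`_i - t`_i| <= d'.
  by move=> i; rewrite (le_trans (st i))// ge_min lexx orbT.
move=> /(_ sn tn) A /(_ sn tn) B.
have -> : f s * g s - f t * g t = f s * (g s - g t) + (f s - f t) * g t by ring.
apply: le_trans (ler_normD _ _) _; rewrite !normrM.
apply: (@le_trans _ _ (`|C| * e' + e' * `|D|)).
  by rewrite lerD// ler_pM ?fC ?gD.
have -> : `|C| * e' + e' * `|D| = (`|C| + `|D|) * e' by ring.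
apply: (@le_trans _ _ ((`|C| + `|D| + 1) * e')).
  by apply: ler_wpM2r; [exact: ltW|lra].
by rewrite /e' mulrC divfK ?gt_eqF.
Qed.

Lemma bucB f g : buc n f -> buc n g -> buc n (fun s => f s - g s).
Proof.
move=> bf bg; apply: eq_buc (bucD bf (bucM (buc_cst (-1)) bg)) => s _.
by rewrite mulN1r.
Qed.

Lemma buc_prod (I : Type) (r : seq I) (P : pred I) (f : I -> seq R -> R) :
  (forall i, P i -> buc n (f i)) -> buc n (fun s => \prod_(i <- r | P i) f i s).
Proof.
move=> fb; elim: r => [|i r IHr].
  by apply: eq_buc (buc_cst 1) => s _; rewrite big_nil.
case Pi: (P i); last by apply: eq_buc IHr => s _; rewrite big_cons Pi.
by apply: eq_buc (bucM (fb i Pi) IHr) => s _; rewrite big_cons Pi.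
Qed.

(** Stability under uniform limits, by the usual three-epsilon argument. It carries regularity from
    polynomial integrands to rational ones. *)
Lemma buc_lim f :
  (forall e, 0 < e -> exists2 g, buc n g &
     forall s, size s = n -> `|f s - g s| <= e) -> buc n f.
Proof.
move=> fg; split.
  have [g [[C gC] _] g1] := fg 1 ltr01; exists (C + 1) => s sn.
  rewrite -[f s](subrK (g s)) addrC.
  by apply: le_trans (ler_normD _ _) _; rewrite lerD ?gC ?g1.
move=> e e0; have e30 : 0 < e / 3 by rewrite divr_gt0.
have [g [_ gu] ge] := fg _ e30.
have [d d0 dP] := gu _ e30; exists d => // s t sn tn st.
have := dP s t sn tn st; have := ge s sn; have := ge t tn.
rewrite !ler_norml => /andP[? ?] /andP[? ?] /andP[? ?].
by apply/andP; split; lra.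
Qed.

(* Heine-Cantor on [-C, C], where C bounds f. *)
Lemma buc_comp (h : R -> R) f : continuous h -> buc n f ->
  buc n (fun s => h (f s)).
Proof.
move=> ch [[C fC] fu]; have cpt : compact `[-C, C]%classic by exact: segment_compact.
split.
  have /compact_bounded[M [Mr MP]] :=
    @continuous_compact _ _ h _ (continuous_subspaceT ch) cpt.
  exists (M + 1) => s sn; apply: (MP (M + 1)); first by rewrite ltrDl.
  by exists (f s) => //=; rewrite in_itv/= -ler_norml fC.
move=> e e0.
suff [d d0 dP] : exists2 d, 0 < d & forall x y, -C <= x <= C -> `|x - y| <= d ->
    `|h x - h y| <= e.
  have [d' d'0 d'P] := fu _ d0; exists d' => // s t sn tn st.
  by apply: dP; [rewrite -ler_norml fC|exact: d'P].
(* Compactness in its near-covering form: it is enough to find, near each point, a modulus valid for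
   all small [d] > 0 and all neighbouring points. *)
have /compact_near_coveringP/(_ R (nbhs 0^'+)%classic
  (fun d x => forall y, `|x - y| <= d -> `|h x - h y| <= e)) := cpt.
case=> [x _|d /= d0 dP].
- have e20 : 0 < e / 2 by rewrite divr_gt0.
  have /cvgrPdist_le/(_ _ e20)[d /= d0 dP] := ch x.
  exists (ball x (d / 2), [set r | 0 < r < d / 2]%classic).
    split; first by apply: nbhsx_ballx; rewrite divr_gt0.
    exists (d / 2); first by rewrite /= divr_gt0.
    by move=> r /=; rewrite sub0r normrN => rd r0; rewrite r0 -[r]gtr0_norm.
  case=> x' r /= [xx' /andP[r0 rd]] y x'y.
  have {}xx' : `|x - x'| < d / 2 by exact: xx'.
  have A : `|h x - h x'| <= e / 2 by apply: dP; rewrite /= (lt_trans xx')//; lra.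
  have B : `|h x - h y| <= e / 2.
    by apply: dP => /=; have := ler_distD x' x y; lra.
  by have := ler_distD (h x) (h x') (h y); rewrite (distrC (h x') (h x)); lra.
- exists (d / 2); first by rewrite divr_gt0.
  move=> x y xC xy; apply: (dP (d / 2)) => //=.
  + by rewrite sub0r normrN gtr0_norm ?divr_gt0//; lra.
  + by rewrite divr_gt0.
Qed.

Lemma buc_nth (h : R -> R) i : (exists C, forall x, `|h x| <= C) ->
  (forall x y, `|h x - h y| <= `|x - y|) -> buc n (fun s => h s`_i).
Proof.
move=> [C hC] hl; split; first by exists C.
by move=> e e0; exists e => // s t _ _ st; apply: le_trans (hl _ _) (st i).
Qed.

End BoundedUniformlyContinuous.

Lemma buc_cons (R : realType) (n : nat) (f : seq R -> R) (x : R) :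
  buc n.+1 f -> buc n (fun s => f (x :: s)).
Proof.
move=> [[C fC] fu]; split; first by exists C => s sn; rewrite fC//= sn.
move=> e e0; have [d d0 dP] := fu e e0; exists d => // s t sn tn st.
by apply: dP => //=; [rewrite sn|rewrite tn|case=> [|i] //=; rewrite subrr normr0 ltW].
Qed.

Section IteratedIntegral.
Context (R : realType).
Implicit Types (f g : seq R -> R) (n : nat).

Local Lemma twopi_ge0 : 0 <= 2 * pi :> R.
Proof. by rewrite mulr_ge0// pi_ge0. Qed.

(** Linearity and the bound are proved in one induction on the dimension. Adding outer integrals
    requires integrability in the first variable, which comes from continuity of the inner integral,
    and that continuity rests on both properties in the lower dimension. *)
Local Definition tint_linear n := forall f g (a : R), buc n f -> buc n g ->
  tint n (fun s => f s + a * g s) = tint n f + a * tint n g.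

Local Definition tint_bounded n := forall f (C : R), buc n f ->
  (forall s, size s = n -> `|f s| <= C) -> `|tint n f| <= (2 * pi) ^+ n * C.

Local Lemma continuous_tint_cons_subproof n f :
  tint_linear n -> tint_bounded n -> buc n.+1 f ->
  continuous (fun x => tint n (fun s => f (x :: s))).
Proof.
move=> lin bnd fb x; apply/cvgrPdist_le => e e0.
have M0 : 0 < (2 * pi : R) ^+ n by rewrite exprn_gt0// mulr_gt0// pi_gt0.
(* The divisor is the volume of the cube over which the inner integral runs. *)
have [_ /(_ (e / (2 * pi) ^+ n))[|d d0 dP]] := fb; first by rewrite divr_gt0.
exists d => //= y /= xy.
have -> : tint n (fun s => f (x :: s)) - tint n (fun s => f (y :: s)) =
    tint n (fun s => f (x :: s) + -1 * f (y :: s)).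
  by rewrite (lin (fun s => f (x :: s)) (fun s => f (y :: s)) (-1)) ?mulN1r//; apply: buc_cons.
rewrite -[e](divfK (lt0r_neq0 M0)) mulrC; apply: bnd.
  by apply: bucD; [exact: buc_cons|apply: bucM; [exact: buc_cst|exact: buc_cons]].
move=> s sn; rewrite mulN1r; apply: dP; rewrite /= ?sn//.
by case=> [|i]/=; [exact: ltW|rewrite subrr normr0 ltW].
Qed.

Local Lemma tint_linear_bounded n : tint_linear n /\ tint_bounded n.
Proof.
elim: n => [|n [lin bnd]].
  by split=> [f g a|f C] //= _ fC; rewrite expr0 mul1r fC.
have cont f := @continuous_tint_cons_subproof n f lin bnd.
split=> [f g a fb gb|f C fb fC] /=.
  under eq_Rintegral => x _ do
    rewrite (lin (fun s => f (x :: s)) (fun s => g (x :: s)) a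
      (buc_cons x fb) (buc_cons x gb)).
  rewrite RintegralD//; last 2 first.
  - by apply: continuous_integrable_itv; exact: cont.
  - apply: (continuous_integrable_itv (H := fun x => a * tint n (fun s => g (x :: s)))) => x.
    by apply: cvgM; [exact: cvg_cst|exact: (cont g gb x)].
  by rewrite RintegralZl//; apply: continuous_integrable_itv; exact: cont.
rewrite exprS -mulrA.
have := @Rintegral_abs_le R (fun x => tint n (fun s => f (x :: s))) 0 (2 * pi)
  ((2 * pi) ^+ n * C) twopi_ge0 (cont f fb).
rewrite subr0; apply=> x; apply: bnd; first exact: buc_cons.
by move=> s sn; rewrite fC//= sn.
Qed.

Lemma tintDM n f g (a : R) : buc n f -> buc n g ->
  tint n (fun s => f s + a * g s) = tint n f + a * tint n g.
Proof. by move: f g a; have [] := tint_linear_bounded n. Qed.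

Lemma tint_le_norm n f (C : R) : buc n f ->
  (forall s, size s = n -> `|f s| <= C) -> `|tint n f| <= (2 * pi) ^+ n * C.
Proof. by move: f C; have [] := tint_linear_bounded n. Qed.

Lemma continuous_tint_cons n f : buc n.+1 f ->
  continuous (fun x => tint n (fun s => f (x :: s))).
Proof.
have [lin bnd] := tint_linear_bounded n.
exact: continuous_tint_cons_subproof.
Qed.

Lemma eq_tint n f g :
  (forall s, size s = n -> f s = g s) -> tint n f = tint n g.
Proof.
elim: n f g => [|n IHn] f g fg /=; first by rewrite fg.
by apply: eq_Rintegral => x _; apply: IHn => s sn; rewrite fg//= sn.
Qed.

Lemma tint0 n : tint n (fun=> 0) = 0 :> R.
Proof.
apply/eqP; rewrite -normr_le0 -[leRHS](mulr0 ((2 * pi) ^+ n)).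
by apply: tint_le_norm => [|s _]; [exact: buc_cst|rewrite normr0].
Qed.

Lemma tintD n f g : buc n f -> buc n g ->
  tint n (fun s => f s + g s) = tint n f + tint n g.
Proof.
move=> fb gb; rewrite -[tint n g]mul1r -tintDM//.
by apply: eq_tint => s _; rewrite mul1r.
Qed.

Lemma tintZ n f (a : R) : buc n f -> tint n (fun s => a * f s) = a * tint n f.
Proof.
move=> fb; have := tintDM a (buc_cst n 0) fb; rewrite tint0 add0r => <-.
by apply: eq_tint => s _; rewrite add0r.
Qed.

(* The faces of the cube, where some coordinate is 0 or 2 pi, are negligible. *)
Lemma eq_tint_interior n f g :
  (forall s, size s = n -> all (fun x => 0 < x < 2 * pi) s -> f s = g s) ->
  buc n g -> tint n f = tint n g.
Proof.
elim: n f g => [|n IHn] f g fg gb /=; first by rewrite fg.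
set F := fun x => tint n (fun s => f (x :: s)).
set G := fun x => tint n (fun s => g (x :: s)).
have FG x : 0 < x < 2 * pi -> F x = G x.
  move=> x02; apply: IHn (buc_cons x gb) => s sn s02.
  by rewrite fg//= ?sn// x02.
have Gi : (@lebesgue_measure R).-integrable `[0, 2 * pi]%classic (EFin \o G).
  exact/continuous_integrable_itv/continuous_tint_cons.
have Goi : (@lebesgue_measure R).-integrable `]0, 2 * pi[%classic (EFin \o G).
  by apply: integrableS Gi => //; exact: subset_itv_oo_cc.
(* Nothing is known of [f] off the open cube, so integrability of [F] is transferred from [G] on the
   open interval. *)
have Foi : (@lebesgue_measure R).-integrable `]0, 2 * pi[%classic (EFin \o F).
  apply: eq_integrable Goi => // x; rewrite inE/= in_itv/= => x02.
  by rewrite FG.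
have cc_oo (h : R -> R) :
    (@lebesgue_measure R).-integrable `]0, 2 * pi[%classic (EFin \o h) ->
    Rintegral (@lebesgue_measure R) `[0, 2 * pi]%classic h =
    Rintegral (@lebesgue_measure R) `]0, 2 * pi[%classic h.
  move=> hi; have /measurable_int mh := hi.
  by rewrite /Rintegral integral_itv_bndoo.
rewrite !cc_oo//; apply: eq_Rintegral => x; rewrite inE/= in_itv/=.
exact: FG.
Qed.

(** Letting the integrand factor through the periodic map [p] makes it periodic in each variable
    separately, so the variables can be shifted one at a time. *)
Lemma tint_shift (T : Type) (p : R -> T) (c : R) n (g : seq T -> R) :
  (forall x, p (x + 2 * pi) = p x) -> buc n (fun s => g (map p s)) ->
  tint n (fun s => g [seq p (x + c) | x <- s]) = tint n (fun s => g (map p s)).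
Proof.
move=> pP; elim: n g => [//|n IHn] g gb /=.
(* The inner variables are shifted first, while the outer one is still shifted and held fixed. *)
under eq_Rintegral => x _.
  rewrite (IHn (fun s => g (p (x + c) :: s))); first over.
  exact: (buc_cons (x + c) gb).
rewrite (@Rintegral_periodic_shift R
  (fun x => tint n (fun s => g (p x :: map p s))) (2 * pi) c)//.
- by rewrite mulr_gt0// pi_gt0.
- exact: (continuous_tint_cons gb).
- by move=> x; rewrite pP.
Qed.

Lemma tint_ge0 n f : (forall s, size s = n -> 0 <= f s) -> 0 <= tint n f.
Proof.
elim: n f => [|n IHn] f f0 /=; first by rewrite f0.
by apply: Rintegral_ge0 => x _; apply: IHn => s sn; rewrite f0//= sn.
Qed.

Lemma tint_gt0 n f s : buc n f -> (forall t, size t = n -> 0 <= f t) ->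
  size s = n -> all (fun x => 0 < x < 2 * pi) s -> 0 < f s -> 0 < tint n f.
Proof.
elim: n f s => [|n IHn] f [|x s]//= fb f0.
move=> [sn] /andP[x02 s02] fs; apply: (@Rintegral_gt0 _ _ _ _ x) => //.
- exact: continuous_tint_cons.
- by move=> y; apply: tint_ge0 => t tn; rewrite f0//= tn.
- apply: (IHn _ s) => //; first exact: buc_cons.
  by move=> t tn; rewrite f0//= tn.
Qed.

End IteratedIntegral.

(** * The complex modulus and the parametrization of the unit circle *)

Section ComplexModulus.
Context (R : realType).
Implicit Types z u : R[i].

Lemma cmodE z : cmod z = normc z.
Proof. by case: z. Qed.

Lemma normc_ge0 z : 0 <= normc z.
Proof. by case: z => a b; exact: sqrtr_ge0. Qed.

Lemma normr_Re_le z : `|complex.Re z| <= normc z.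
Proof. by case: z => a b /=; rewrite -sqrtr_sqr ler_wsqrtr// lerDl sqr_ge0. Qed.

Lemma normr_Im_le z : `|complex.Im z| <= normc z.
Proof. by case: z => a b /=; rewrite -sqrtr_sqr ler_wsqrtr// lerDr sqr_ge0. Qed.

Lemma normc_le_ReIm z : normc z <= `|complex.Re z| + `|complex.Im z|.
Proof.
case: z => a b /=; rewrite -[leRHS]ger0_norm ?addr_ge0// -sqrtr_sqr ler_wsqrtr//.
rewrite sqrrD !real_normK ?num_real// mulr2n.
by have := mulr_ge0 (normr_ge0 a) (normr_ge0 b); lra.
Qed.

Lemma normc_le_add (x y : R[i]) : normc (x + y) <= normc x + normc y.
Proof. exact: (@le_normcD R). Qed.

Lemma normc_opp (x : R[i]) : normc (- x) = normc x.
Proof. exact: (@normcN R). Qed.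

Lemma normc_real (x : R) : normc x%:C%C = `|x|.
Proof. by rewrite /= expr0n addr0 sqrtr_sqr. Qed.

Lemma normcX z n : normc (z ^+ n) = normc z ^+ n.
Proof. by elim: n => [|n IHn]; rewrite ?expr0 ?normc1// !exprS normcM IHn. Qed.

Lemma normc_conj z : normc (conjc z) = normc z.
Proof. by case: z => a b /=; rewrite sqrrN. Qed.

Lemma normc_gt0 z : z != 0 -> 0 < normc z.
Proof.
by move=> z0; rewrite lt_neqAle normc_ge0 andbT eq_sym;
  apply: contra z0 => /eqP/eq0_normc->.
Qed.

Lemma mulc_conj_norm1 z : normc z = 1 -> z * conjc z = 1.
Proof.
case: z => a b /= ab; have {}ab : a ^+ 2 + b ^+ 2 = 1.
  by rewrite -[LHS]sqr_sqrtr ?addr_ge0 ?sqr_ge0// ab expr1n.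
apply/eqP; rewrite eq_complex /=; apply/andP; split; apply/eqP; last by ring.
by rewrite -ab; ring.
Qed.

Lemma eitD (x y : R) : eit (x + y) = eit x * eit y.
Proof.
apply/eqP; rewrite eq_complex /= cosD sinD eqxx /=; apply/eqP; ring.
Qed.

Lemma eit0 : eit 0 = 1 :> R[i].
Proof. by rewrite /eit cos0 sin0. Qed.

Lemma eitMn (x : R) n : eit (x *+ n) = eit x ^+ n.
Proof. by elim: n => [|n IHn]; rewrite ?mulr0n ?eit0// mulrS eitD IHn exprS. Qed.

Lemma eit2pi (x : R) : eit (x + 2 * pi) = eit x.
Proof. by rewrite /eit mulrC mulr_natr cosD2pi sinD2pi. Qed.

Lemma normc_eit (x : R) : normc (eit x) = 1.
Proof. by rewrite /= cos2Dsin2 sqrtr1. Qed.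

(** By the double angle formula, cos x = 1 would force sin (x/2) = 0, although 0 < x/2 < pi. *)
Lemma eit_neq1 (x : R) : 0 < x < 2 * pi -> eit x != 1.
Proof.
move=> /andP[x0 x2]; rewrite eq_complex /= negb_and; apply/orP; left.
have := @sin_gt0_pi R (x / 2); rewrite divr_gt0//= => /(_ _)/lt0r_neq0 s0.
have -> : x = (x / 2) *+ 2 by rewrite mulr2n; lra.
rewrite cos_mulr2n; apply/eqP => c1; move: (cos2Dsin2 (x / 2)) => cs.
have : sin (x / 2) ^+ 2 = 0 by move: c1; rewrite mulr2n; lra.
move/eqP; rewrite sqrf_eq0; apply/negP/s0.
by lra.
Qed.

End ComplexModulus.

(** * Continuity estimates for sine, cosine and real powers *)

Section TrigLipschitz.
Context (R : realType).

Lemma lipschitz_of_derive (h h' : R -> R) :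
  (forall x, is_derive x (1 : R) h (h' x)) -> (forall x, `|h' x| <= 1) ->
  forall x y, `|h x - h y| <= `|x - y|.
Proof.
move=> hd h1 x y; wlog xy : x y / x <= y.
  by move=> main; case: (leP x y) => [/main//|/ltW/main]; rewrite distrC [leRHS]distrC.
have [z _ E] : exists2 z, z \in `[x, y]%R & h y - h x = h' z * (y - x).
  apply: MVT_segment => //.
  apply: derivable_within_continuous => z _.
  exact: (@ex_derive _ _ _ _ _ _ _ (hd z)).
by rewrite distrC E normrM [leRHS]distrC ler_piMl.
Qed.

Lemma cos_lipschitz (x y : R) : `|cos x - cos y| <= `|x - y|.
Proof.
apply: (lipschitz_of_derive (h' := fun x => - sin x)) => z.
by rewrite normrN ler_norml sin_geN1 sin_le1.
Qed.

Lemma sin_lipschitz (x y : R) : `|sin x - sin y| <= `|x - y|.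
Proof.
apply: (lipschitz_of_derive (h' := cos)) => z.
by rewrite ler_norml cos_geN1 cos_le1.
Qed.

(** Away from 0 this follows from differentiability of the power on positive reals. At 0, where two
    points of the ensemble collide, |y| < e^(1/a) gives |y|^a <= e. *)
Lemma continuous_powR_norm (a : R) : 0 < a -> continuous (fun x : R => `|x| `^ a).
Proof.
move=> a0 x; have [->|x0] := eqVneq x 0; last first.
  apply: (@continuous_comp _ _ _ (fun x : R => `|x|) (fun x : R => x `^ a)).
    exact: norm_continuous.
  apply: differentiable_continuous; apply/derivable1_diffP.
  by apply: derivable_powR; rewrite in_itv/= andbT normr_gt0.
apply/cvgrPdist_le => e e0; exists (e `^ a^-1); first by rewrite /= powR_gt0.
move=> y /=; rewrite sub0r normrN => ye.
rewrite normr0 powR0 ?gt_eqF// sub0r normrN ger0_norm ?powR_ge0//.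
apply: (@le_trans _ _ ((e `^ a^-1) `^ a)); last first.
  by rewrite -powRrM mulVf ?gt_eqF// powRr1// ltW.
by apply: ge0_ler_powR; rewrite ?nnegrE ?powR_ge0//; exact: ltW.
Qed.

End TrigLipschitz.

(** * Iterated integrals of complex-valued functions *)

Definition cbuc (R : realType) (n : nat) (f : seq R -> R[i]) :=
  buc n (fun s => complex.Re (f s)) /\ buc n (fun s => complex.Im (f s)).

Section ComplexIntegral.
Context (R : realType) (n : nat).
Implicit Types f g : seq R -> R[i].

Lemma eq_cbuc f g : (forall s, size s = n -> f s = g s) -> cbuc n f -> cbuc n g.
Proof.
by move=> fg [re im]; split; [apply: eq_buc re|apply: eq_buc im] => s sn; rewrite fg.
Qed.

Lemma cbuc_cst (c : R[i]) : cbuc n (fun=> c).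
Proof. by split; exact: buc_cst. Qed.

Lemma cbuc_real (f : seq R -> R) : buc n f -> cbuc n (fun s => (f s)%:C%C).
Proof. by move=> fb; split=> //=; exact: buc_cst. Qed.

Lemma cbucD f g : cbuc n f -> cbuc n g -> cbuc n (fun s => f s + g s).
Proof.
move=> [rf jf] [rg jg]; split.
  by apply: eq_buc (bucD rf rg) => s _; case: (f s) (g s) => [? ?] [? ?].
by apply: eq_buc (bucD jf jg) => s _; case: (f s) (g s) => [? ?] [? ?].
Qed.

Lemma cbucM f g : cbuc n f -> cbuc n g -> cbuc n (fun s => f s * g s).
Proof.
move=> [rf jf] [rg jg]; split.
  by apply: eq_buc (bucB (bucM rf rg) (bucM jf jg)) => s _; case: (f s) (g s) => [? ?] [? ?].
by apply: eq_buc (bucD (bucM rf jg) (bucM jf rg)) => s _; case: (f s) (g s) => [? ?] [? ?].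
Qed.

Lemma cbuc_conj f : cbuc n f -> cbuc n (fun s => conjc (f s)).
Proof.
move=> [rf jf]; split.
  by apply: eq_buc rf => s _; case: (f s).
by apply: eq_buc (bucM (buc_cst n (-1)) jf) => s _; case: (f s) => a b; rewrite mulN1r.
Qed.

Lemma cbuc_sum (I : Type) (r : seq I) (f : I -> seq R -> R[i]) :
  (forall i, cbuc n (f i)) -> cbuc n (fun s => \sum_(i <- r) f i s).
Proof.
move=> fb; elim: r => [|i r IHr].
  by apply: eq_cbuc (cbuc_cst 0) => s _; rewrite big_nil.
by apply: eq_cbuc (cbucD (fb i) IHr) => s _; rewrite big_cons.
Qed.

Lemma cbuc_prod (I : Type) (r : seq I) (f : I -> seq R -> R[i]) :
  (forall i, cbuc n (f i)) -> cbuc n (fun s => \prod_(i <- r) f i s).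
Proof.
move=> fb; elim: r => [|i r IHr].
  by apply: eq_cbuc (cbuc_cst 1) => s _; rewrite big_nil.
by apply: eq_cbuc (cbucM (fb i) IHr) => s _; rewrite big_cons.
Qed.

Lemma cbuc_lim f :
  (forall e, 0 < e -> exists2 g, cbuc n g &
     forall s, size s = n -> normc (f s - g s) <= e) -> cbuc n f.
Proof.
move=> fg; split; apply: buc_lim => e /fg[g [rg jg] gP].
  exists (fun s => complex.Re (g s)) => // s /gP; apply: le_trans.
  by rewrite (le_trans _ (normr_Re_le _))//; case: (f s) (g s) => [? ?] [? ?].
exists (fun s => complex.Im (g s)) => // s /gP; apply: le_trans.
by rewrite (le_trans _ (normr_Im_le _))//; case: (f s) (g s) => [? ?] [? ?].
Qed.

Lemma cbuc_eit i : cbuc n (fun s : seq R => eit s`_i).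
Proof.
split; rewrite /=; apply: (buc_nth n i).
- by exists 1 => x; rewrite ler_norml cos_geN1 cos_le1.
- exact: cos_lipschitz.
- by exists 1 => x; rewrite ler_norml sin_geN1 sin_le1.
- exact: sin_lipschitz.
Qed.

Lemma eq_ctint f g :
  (forall s, size s = n -> f s = g s) -> ctint n f = ctint n g.
Proof. by move=> fg; rewrite /ctint; congr Complex; apply: eq_tint => s sn; rewrite fg. Qed.

Lemma eq_ctint_interior f g :
  (forall s, size s = n -> all (fun x => 0 < x < 2 * pi) s -> f s = g s) ->
  cbuc n g -> ctint n f = ctint n g.
Proof.
move=> fg [rg jg]; rewrite /ctint; congr Complex; apply: eq_tint_interior => // s sn s02;
  by rewrite fg.
Qed.

Lemma ctintD f g : cbuc n f -> cbuc n g ->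
  ctint n (fun s => f s + g s) = ctint n f + ctint n g.
Proof.
move=> [rf jf] [rg jg]; apply/eqP; rewrite eq_complex /= -!tintD//.
by apply/andP; split; apply/eqP; apply: eq_tint => s _; case: (f s) (g s) => [? ?] [? ?].
Qed.

Lemma ctintZ (c : R[i]) f : cbuc n f -> ctint n (fun s => c * f s) = c * ctint n f.
Proof.
case: c => a b [rf jf]; apply/eqP; rewrite eq_complex /=.
have r0 (d : R) := bucM (buc_cst n d) rf; have j0 (d : R) := bucM (buc_cst n d) jf.
rewrite -mulNr -!tintZ// -!tintD//.
by apply/andP; split; apply/eqP; apply: eq_tint => s _; case: (f s) => [? ?] /=; rewrite ?mulNr.
Qed.

Lemma ctint_conj f : cbuc n f -> ctint n (fun s => conjc (f s)) = conjc (ctint n f).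
Proof.
move=> [rf jf]; apply/eqP; rewrite eq_complex /= -mulN1r -tintZ//.
by apply/andP; split; apply/eqP; apply: eq_tint => s _; case: (f s) => [? ?] /=; rewrite ?mulN1r.
Qed.

Lemma ctint_real (f : seq R -> R) : ctint n (fun s => (f s)%:C%C) = (tint n f)%:C%C.
Proof. by rewrite /ctint /= tint0. Qed.

Lemma ctint_sum (I : Type) (r : seq I) (f : I -> seq R -> R[i]) :
  (forall i, cbuc n (f i)) ->
  ctint n (fun s => \sum_(i <- r) f i s) = \sum_(i <- r) ctint n (f i).
Proof.
move=> fb; elim: r => [|i r IHr].
  rewrite big_nil -[RHS](mul0r (ctint n (fun=> 0))) -ctintZ; last exact: cbuc_cst.
  by apply: eq_ctint => s _; rewrite big_nil mul0r.
rewrite big_cons -IHr -ctintD//; last exact: cbuc_sum.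
by apply: eq_ctint => s _; rewrite big_cons.
Qed.

(** The factor 2 comes from bounding real and imaginary parts separately; this crude constant is
    enough for passing to uniform limits. *)
Lemma normc_ctint_le f (C : R) : cbuc n f ->
  (forall s, size s = n -> normc (f s) <= C) ->
  normc (ctint n f) <= 2 * ((2 * pi) ^+ n * C).
Proof.
move=> [rf jf] fC; apply: le_trans (normc_le_ReIm _) _ => /=.
rewrite mulr_natl mulr2n lerD//; apply: tint_le_norm => // s sn;
  [exact: le_trans (normr_Re_le _) (fC s sn)|exact: le_trans (normr_Im_le _) (fC s sn)].
Qed.

(** The form suits the polynomial approximation: all approximants have exactly the same integral
    [A], so the integral of [f] is within every positive distance of [A]. *)
Lemma ctint_lim f (A : R[i]) :
  (forall e, 0 < e -> exists g, [/\ cbuc n g, ctint n g = A &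
     forall s, size s = n -> normc (f s - g s) <= e]) -> ctint n f = A.
Proof.
move=> fg; have fb : cbuc n f.
  by apply: cbuc_lim => e /fg[g [gb _ gP]]; exists g.
apply/eqP; rewrite -subr_eq0; apply/eqP/eq0_normc/eqP.
rewrite eq_le normc_ge0 andbT; apply/ler_addgt0Pl => e e0; rewrite addr0.
have M0 : 0 < (2 * pi : R) ^+ n by rewrite exprn_gt0// mulr_gt0// pi_gt0.
have [|g [gb <- gP]] := fg (e / (2 * (2 * pi) ^+ n)).
  by rewrite divr_gt0// mulr_gt0.
have gb' := cbucM (cbuc_cst (-1)) gb.
rewrite -[X in _ - X]mul1r -mulNr -ctintZ// -ctintD//.
rewrite -[leRHS](divfK (_ : 2 * (2 * pi) ^+ n != 0)); last by rewrite gt_eqF// mulr_gt0.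
rewrite [leRHS]mulrC -mulrA; apply: normc_ctint_le; first exact: cbucD.
by move=> s sn; rewrite mulN1r gP.
Qed.

End ComplexIntegral.

(** * Rotation invariance *)

Section CircularEnsemble.
Context (R : realType) (beta : R).
Hypothesis beta_gt0 : 0 < beta.
Implicit Types (us : seq R[i]).

(** The density in terms of the points instead of their angles, so that a rotation acts by
    multiplication. *)
Definition weight us : R :=
  \prod_(j < size us) \prod_(k < size us | (j < k)%N)
     (cmod (us`_j - us`_k)) `^ beta.

Lemma cbe_density_weight (s : seq R) : cbe_density beta s = weight (map (@eit R) s).
Proof.
rewrite /weight size_map; apply: eq_bigr => j _; apply: eq_bigr => k _.
by rewrite !(nth_map 0).
Qed.

Lemma weight_rot (c : R[i]) us : normc c = 1 -> weight (map ( *%R c) us) = weight us.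
Proof.
move=> c1; rewrite /weight size_map; apply: eq_bigr => j _; apply: eq_bigr => k _.
by rewrite !(nth_map 0)// -mulrBr !cmodE normcM c1 mul1r.
Qed.

Lemma buc_cbe_density n : buc n (@cbe_density R beta).
Proof.
(* The absolute value is inserted because x^beta is composed here in the form |x|^beta, continuous
   on the whole line. *)
apply: (eq_buc (f := fun s => \prod_(j < n) \prod_(k < n | (j < k)%N)
    (`|cmod (eit s`_j - eit s`_k)| `^ beta))).
  move=> s sn; rewrite /cbe_density sn.
  by apply: eq_bigr => j _; apply: eq_bigr => k _; rewrite ger0_norm// sqrtr_ge0.
apply: buc_prod => j _; apply: buc_prod => k _.
apply: (buc_comp (h := fun x : R => `|x| `^ beta)); first exact: continuous_powR_norm.
apply: (buc_comp (h := @Num.sqrt R)); first exact: sqrt_continuous.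
have [re_j im_j] := cbuc_eit R n j; have [re_k im_k] := cbuc_eit R n k.
have re := bucB re_j re_k; have im := bucB im_j im_k.
exact: bucD (bucM re re) (bucM im im).
Qed.

Lemma cbe_density_ge0 (s : seq R) : 0 <= cbe_density beta s.
Proof. by apply: prodr_ge0 => j _; apply: prodr_ge0 => k _; exact: powR_ge0. Qed.

(** The density is continuous and nonnegative, so one interior configuration of distinct points
    suffices. *)
Lemma tint_cbe_density_gt0 n : 0 < tint n (@cbe_density R beta).
Proof.
(* Equally spaced angles strictly between 0 and pi, where the cosine is injective and hence
   separates the points. *)
pose s : seq R := mkseq (fun k => k.+1%:R * pi / n.+1%:R) n.
have pi0 : 0 < pi :> R by exact: pi_gt0.
have s_lt k : (k < n)%N -> 0 < s`_k < pi.
  move=> kn; rewrite nth_mkseq//; apply/andP; split.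
    by rewrite divr_gt0 ?mulr_gt0 ?ltr0n.
  by rewrite ltr_pdivrMr ?ltr0n// mulrC ltr_pM2l// ltr_nat ltnS.
apply: (tint_gt0 (s := s)).
- exact: buc_cbe_density.
- by move=> *; exact: cbe_density_ge0.
- by rewrite size_mkseq.
- apply/(all_nthP 0) => k; rewrite size_mkseq => /s_lt/andP[-> /lt_trans->//].
  by rewrite mulr_natl mulr2n ltrDl.
- rewrite /cbe_density size_mkseq; apply: prodr_gt0 => j _; apply: prodr_gt0 => k jk.
  apply: powR_gt0; rewrite cmodE; apply: normc_gt0; rewrite subr_eq0.
  apply/eqP => - [/cos_inj E _]; move: jk; rewrite ltn_neqAle => /andP[/eqP jk _].
  have /andP[/ltW j0 /ltW jpi] := s_lt j (ltn_ord j).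
  have /andP[/ltW k0 /ltW kpi] := s_lt k (ltn_ord k).
  have : s`_j = s`_k by apply: E; rewrite in_itv/= ?j0 ?k0.
  rewrite !nth_mkseq// => /(congr1 (fun x => x * n.+1%:R / pi)).
  rewrite !divfK ?pnatr_eq0// !mulfK ?gt_eqF// => /eqP.
  by rewrite eqr_nat eqSS => /eqP.
Qed.

(** The expectation before normalization; the division by the partition function is dealt with once,
    in [cbe_E_prod]. *)
Definition cbe_int n (F : seq R[i] -> R[i]) : R[i] :=
  ctint n (fun s => F (map (@eit R) s) * (weight (map (@eit R) s))%:C%C).

Definition cbe_regular n (F : seq R[i] -> R[i]) := cbuc n (fun s => F (map (@eit R) s)).

Lemma cbuc_cbe n F : cbe_regular n F ->
  cbuc n (fun s => F (map (@eit R) s) * (weight (map (@eit R) s))%:C%C).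
Proof.
move=> rF; apply: cbucM => //; apply: cbuc_real.
by apply: eq_buc (buc_cbe_density n) => s _; rewrite cbe_density_weight.
Qed.

Lemma eq_cbe_int n F G : (forall us, size us = n -> F us = G us) ->
  cbe_int n F = cbe_int n G.
Proof. by move=> FG; apply: eq_ctint => s sn; rewrite FG// size_map. Qed.

Lemma cbe_intZ n (c : R[i]) F : cbe_regular n F ->
  cbe_int n (fun us => c * F us) = c * cbe_int n F.
Proof.
move=> /cbuc_cbe Fb; rewrite [in RHS]/cbe_int -ctintZ//.
by apply: eq_ctint => s _; rewrite mulrA.
Qed.

Lemma cbe_int_sum n (I : Type) (r : seq I) (F : I -> seq R[i] -> R[i]) :
  (forall i, cbe_regular n (F i)) ->
  cbe_int n (fun us => \sum_(i <- r) F i us) = \sum_(i <- r) cbe_int n (F i).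
Proof.
move=> rF; have Fb i := cbuc_cbe (rF i).
by rewrite [in RHS]/cbe_int -ctint_sum//; apply: eq_ctint => s _; rewrite mulr_suml.
Qed.

(** Multiplying all points by e^(ic) shifts all angles by [c]. This preserves integrals over full
    periods, and the weight depends only on mutual distances. *)
Lemma cbe_int_rot n F (c : R) : cbe_regular n F ->
  cbe_int n (fun us => F (map ( *%R (eit c)) us)) = cbe_int n F.
Proof.
move=> rF; have [re im] := cbuc_cbe rF.
have rot s : [seq eit c * u | u <- map (@eit R) s] = [seq eit (x + c) | x <- s].
  by rewrite -map_comp; apply: eq_map => x /=; rewrite addrC eitD.
rewrite /cbe_int /ctint; congr Complex.
  rewrite -[RHS](tint_shift (g := fun us => complex.Re (F us * (weight us)%:C%C)) c
    (@eit2pi R) re); apply: eq_tint => s _.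
  by rewrite -rot weight_rot// normc_eit.
rewrite -[RHS](tint_shift (g := fun us => complex.Im (F us * (weight us)%:C%C)) c
    (@eit2pi R) im); apply: eq_tint => s _.
by rewrite -rot weight_rot// normc_eit.
Qed.

(** A geometric sum of ratio x^i: multiplied by the nonzero x^i - 1 it telescopes to (x^N)^i - 1 =
    0. *)
Lemma sum_expr_unity (N i : nat) (x : R[i]) : x ^+ N = 1 -> (0 < i)%N -> x ^+ i != 1 ->
  \sum_(a < N) (x ^+ a) ^+ i = 0.
Proof.
move=> xN i0 xi1.
have E : (x ^+ i - 1) * (\sum_(a < N) (x ^+ i) ^+ a) = 0.
  by rewrite -subrX1 exprAC xN expr1n subrr.
under eq_bigr do rewrite exprAC.
by move/eqP: E; rewrite mulf_eq0 subr_eq0 (negPf xi1) => /eqP.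
Qed.

(* Averaging over the N-th roots of unity kills all the coefficients of a
   polynomial of degree less than N but the constant one. *)
Lemma mean_unity_roots (N : nat) (Q : {poly R[i]}) : (0 < N)%N -> (size Q <= N)%N ->
  \sum_(a < N) Q.[eit (2 * pi / N%:R) ^+ a] = N%:R * Q.[0].
Proof.
move=> N0 QN; set x := eit _.
have xi (i : nat) : (0 < i < N)%N -> x ^+ i != 1.
  move=> /andP[i0 iN]; rewrite -eitMn; apply: eit_neq1.
  have pi0 : 0 < 2 * pi :> R by rewrite mulr_gt0// pi_gt0.
  rewrite pmulrn_lgt0// divr_gt0 ?ltr0n//=.
  by rewrite -[X in X < _]mulr_natr mulrAC ltr_pdivrMr ?ltr0n// ltr_pM2l// ltr_nat.
have xN : x ^+ N = 1.
  rewrite -eitMn -[X in eit X]mulr_natr divfK ?pnatr_eq0 -?lt0n//.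
  by rewrite -[2 * pi]add0r eit2pi eit0.
under eq_bigr do rewrite (horner_coef_wide _ QN).
rewrite exchange_big /=.
case: N N0 QN x xi xN => // N _ QN x xi xN.
(* After exchanging the sums, every coefficient of positive index is multiplied by a vanishing sum
   over roots of unity. *)
rewrite big_ord_recl /= [X in _ + X]big1 ?addr0; last first.
  move=> i _; rewrite -mulr_sumr sum_expr_unity ?mulr0//.
  by apply: xi; rewrite /bump /= add1n ltnS.
rewrite (eq_bigr (fun=> Q`_0)) => [|a _]; last by rewrite expr0 mulr1.
by rewrite sumr_const card_ord horner_coef0 mulr_natl.
Qed.

Lemma cbe_regular_prod n (P : R[i] -> R[i]) :
  (forall i, cbuc n (fun s : seq R => P (eit s`_i))) ->
  cbe_regular n (fun us => \prod_(u <- us) P u).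
Proof.
move=> rP; apply: eq_cbuc (cbuc_prod (index_enum 'I_n) rP) => s sn.
by rewrite big_map (big_nth 0) big_mkord sn.
Qed.

Lemma cbuc_horner n (P : {poly R[i]}) f : cbuc n f -> cbuc n (fun s : seq R => P.[f s]).
Proof.
move=> fb; elim/poly_ind: P => [|P c IHP].
  by apply: eq_cbuc (cbuc_cst n 0) => s _; rewrite horner0.
by apply: eq_cbuc (cbucD (cbucM IHP fb) (cbuc_cst n c)) => s _; rewrite hornerMXaddC.
Qed.

Lemma cbe_regular_poly n (P : {poly R[i]}) :
  cbe_regular n (fun us => \prod_(u <- us) P.[u]).
Proof. by apply: cbe_regular_prod => i; apply: cbuc_horner; exact: cbuc_eit. Qed.

Lemma cbe_int_poly n (P : {poly R[i]}) :
  cbe_int n (fun us => \prod_(u <- us) P.[u]) = P.[0] ^+ n * cbe_int n (fun=> 1).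
Proof.
(* For fixed points, a polynomial in the rotation y whose value is the product of the P(yu); its
   value at 0 is P(0)^n. *)
pose Q us := \prod_(u <- us) (P \Po (u *: 'X)).
(* Bounds the size of [Q us] uniformly in the configuration, so one group of roots of unity serves
   for all of them. *)
pose N := (n * size P).+1.
have QN us : size us = n -> (size (Q us) <= N)%N.
  rewrite /N => <-; rewrite /Q; elim: us => [|u us IHus].
    by rewrite big_nil size_poly1.
  rewrite big_cons; apply: leq_trans (size_polyMleq _ _) _.
  have uX : (size (u *: 'X : {poly R[i]}) <= 2)%N.
    by rewrite (leq_trans (size_scale_leq _ _))// size_polyX.
  have := size_comp_poly_leq P (u *: 'X).
  have : ((size P).-1 * (size (u *: 'X)).-1 <= (size P).-1)%N.
    by rewrite -[leqRHS]muln1 leq_mul2l; apply/orP; right; case: (size (u *: 'X)) uX.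
  move=> A /leq_trans/(_ (A : (_ < _.+1)%N)) {A}; rewrite /= mulSn.
  move: IHus; move: (size (polyseq (\prod_(_ <- us) _))) (size (polyseq (_ \Po _)))
    (size us * size P)%N.
  by move: (size P) => ? ? ? ?; lia.
pose x := eit (2 * pi / N%:R : R).
have rP := cbe_regular_poly n P.
have rPx a : cbe_regular n (fun us => \prod_(u <- map ( *%R (eit a)) us) P.[u]).
  under eq_fun do rewrite big_map.
  apply: cbe_regular_prod => i; apply: cbuc_horner; apply: cbucM; first exact: cbuc_cst.
  exact: cbuc_eit.
have N0 : N%:R != 0 :> R[i] by rewrite pnatr_eq0.
(* Both sides are multiplied by [N]: of the resulting [N] copies of the integral, the copy of index
   a is then rotated by x^a. *)
apply: (mulfI N0); transitivity (\sum_(a < N) cbe_int n (fun us => \prod_(u <- us) P.[u])).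
  by rewrite sumr_const card_ord mulr_natl.
transitivity (\sum_(a < N)
    cbe_int n (fun us => \prod_(u <- map ( *%R (x ^+ a)) us) P.[u])).
  by apply: eq_bigr => a _; rewrite -eitMn; exact/esym/(cbe_int_rot _ rP).
rewrite mulrA -cbe_intZ; last exact: (cbuc_cst n 1).
rewrite -cbe_int_sum; last by move=> a; rewrite -eitMn.
apply: eq_cbe_int => us un; rewrite mulr1.
have QE y : (Q us).[y] = \prod_(u <- us) P.[y * u].
  rewrite horner_prod; apply: eq_bigr => u _.
  by rewrite horner_comp hornerZ hornerX mulrC.
transitivity (\sum_(a < N) (Q us).[x ^+ a]).
  by apply: eq_bigr => a _; rewrite QE big_map.
rewrite mean_unity_roots ?QN// QE; under eq_bigr do rewrite mul0r.
by rewrite big_const_seq count_predT un iter_mulr_1.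
Qed.

End CircularEnsemble.

(** * Approximation by polynomials on the unit circle *)

(** All approximants have exactly the value [c] at 0, the only value that survives averaging over
    rotations. As [G] is constrained on the unit circle only, [c] may differ from [G 0]. *)
Definition circle_approx (R : realType) (G : R[i] -> R[i]) (c : R[i]) :=
  forall e, 0 < e -> exists2 P : {poly R[i]}, P.[0] = c &
    forall u, normc u = 1 -> normc (P.[u] - G u) <= e.

Section CircleApprox.
Context (R : realType).
Implicit Types (G : R[i] -> R[i]) (c : R[i]).

Lemma horner_circle_bounded (P : {poly R[i]}) :
  exists2 C, 0 <= C & forall u, normc u = 1 -> normc P.[u] <= C.
Proof.
elim/poly_ind: P => [|P c [C C0 PC]].
  by exists 0 => // u _; rewrite horner0 normc0.
exists (C + normc c) => [|u u1]; first by rewrite addr_ge0 ?normc_ge0.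
rewrite hornerMXaddC; apply: le_trans (normc_le_add _ _) _.
by rewrite lerD2r normcM u1 mulr1 PC.
Qed.

Lemma circle_approx_bounded G c : circle_approx G c ->
  exists2 C, 0 <= C & forall u, normc u = 1 -> normc (G u) <= C.
Proof.
move=> /(_ 1 ltr01)[P _ PG]; have [C C0 PC] := horner_circle_bounded P.
exists (C + 1) => [|u u1]; first by rewrite addr_ge0.
rewrite -[G u](subKr P.[u]); apply: le_trans (normc_le_add _ _) _.
by rewrite normc_opp lerD ?PC ?PG.
Qed.

Lemma eq_circle_approx G G' c : (forall u, normc u = 1 -> G u = G' u) ->
  circle_approx G c -> circle_approx G' c.
Proof.
move=> GG' aG e /aG[P P0 PG]; exists P => // u u1.
by rewrite -GG'// PG.
Qed.

Lemma circle_approx_poly (P : {poly R[i]}) : circle_approx (horner P) P.[0].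
Proof. by move=> e e0; exists P => // u _; rewrite subrr normc0 ltW. Qed.

Lemma circle_approxM G G' c c' : circle_approx G c -> circle_approx G' c' ->
  circle_approx (fun u => G u * G' u) (c * c').
Proof.
move=> aG aG' e e0.
have [A A0 GA] := circle_approx_bounded aG.
have [B B0 GB] := circle_approx_bounded aG'.
have K0 : 0 < A + 1 + B by lra.
(* With [d] at most 1 the first approximant is bounded by A + 1 on the circle, and the error of the
   product is at most (A + 1) d + d B. *)
pose d := Num.min 1 (e / (A + 1 + B)).
have d0 : 0 < d by rewrite lt_min ltr01 divr_gt0.
have d1 : d <= 1 by rewrite ge_min lexx.
have de : d * (A + 1 + B) <= e by rewrite -ler_pdivlMr// ge_min lexx orbT.
have [P P0 PG] := aG d d0; have [Q Q0 QG] := aG' d d0.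
exists (P * Q) => [|u u1]; first by rewrite hornerM P0 Q0.
rewrite hornerM.
have -> : P.[u] * Q.[u] - G u * G' u =
    P.[u] * (Q.[u] - G' u) + (P.[u] - G u) * G' u by ring.
apply: le_trans (normc_le_add _ _) _; rewrite !normcM.
have PA : normc P.[u] <= A + 1.
  rewrite -[P.[u]](subrK (G u)) addrC; apply: le_trans (normc_le_add _ _) _.
  by rewrite lerD ?GA// (le_trans (PG u u1)).
apply: le_trans de; rewrite mulrDr [d * (A + 1)]mulrC.
by apply: lerD; apply: ler_pM; rewrite ?normc_ge0 ?PG ?QG ?GB.
Qed.

Lemma circle_approx_prod (I : Type) (r : seq I) (G : I -> R[i] -> R[i]) (c : I -> R[i]) :
  (forall i, circle_approx (G i) (c i)) ->
  circle_approx (fun u => \prod_(i <- r) G i u) (\prod_(i <- r) c i).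
Proof.
move=> aG; elim: r => [|i r IHr].
  have := circle_approx_poly (1%:P : {poly R[i]}); rewrite hornerC big_nil.
  by apply: eq_circle_approx => u _; rewrite big_nil hornerC.
rewrite big_cons; apply: eq_circle_approx (circle_approxM (aG i) IHr) => u _.
by rewrite big_cons.
Qed.

(** Partial sums of the geometric series in au: they equal 1 at 0, and on the circle the remainder
    is at most |a|^(M+1) / (1 - |a|). *)
Lemma circle_approx_geometric (a : R[i]) : normc a < 1 ->
  circle_approx (fun u => (1 - a * u)^-1) 1.
Proof.
move=> a1 e e0.
have /cvgrPdist_lt/(_ (e * (1 - normc a))) : ((fun k => normc a ^+ k) @ \oo --> (0 : R))%classic.
  by apply: cvg_expr; rewrite ger0_norm ?normc_ge0.
rewrite mulr_gt0 ?subr_gt0// => /(_ isT)[M _ /(_ M.+1 (leqnSn M))].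
rewrite sub0r normrN ger0_norm ?exprn_ge0 ?normc_ge0// => aM.
exists (\sum_(k < M.+1) (a *: 'X) ^+ k) => [|u u1].
  rewrite horner_sum big_ord_recl big1 ?addr0 => [|k _].
    by rewrite expr0 hornerC.
  by rewrite horner_exp hornerZ hornerX mulr0 expr0n.
have -> : (\sum_(k < M.+1) (a *: 'X) ^+ k).[u] = \sum_(k < M.+1) (a * u) ^+ k.
  by rewrite horner_sum; apply: eq_bigr => k _; rewrite horner_exp hornerZ hornerX.
have au : normc (a * u) = normc a by rewrite normcM u1 mulr1.
have low : 1 - normc a <= normc (1 - a * u).
  rewrite lerBlDr -au -{1}(normc1 R) -{1}(subrK (a * u) 1).
  exact: normc_le_add.
have pos : 0 < normc (1 - a * u) by rewrite (lt_le_trans _ low)// subr_gt0.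
have nz : 1 - a * u != 0.
  by apply: contraTneq pos => ->; rewrite normc0 ltxx.
have -> : \sum_(k < M.+1) (a * u) ^+ k - (1 - a * u)^-1 =
    - ((a * u) ^+ M.+1 / (1 - a * u)).
  apply: (mulIf nz); rewrite mulrBl mulVf// mulNr divfK//.
  by rewrite -[(a * u) ^+ M.+1](subrK 1) subrX1; ring.
rewrite normc_opp normcM normcX normcV au ler_pdivrMr//.
by apply: (le_trans (ltW aM)); rewrite ler_pM2l.
Qed.

(** The quotient is the polynomial (a - u)/b times 1/(1 - u/b), a geometric series of ratio less
    than 1 in modulus. *)
Lemma circle_approx_outside (a b : R[i]) : 1 < normc b ->
  circle_approx (fun u => (a - u) / (b - u)) (a / b).
Proof.
move=> b1; have b0 : b != 0.
  by apply: contraTneq b1 => ->; rewrite normc0 ltNge ler01.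
have bV1 : normc b^-1 < 1 by rewrite normcV invf_lt1// (lt_trans _ b1).
have -> : a / b = (b^-1 *: (a%:P - 'X)).[0] * 1.
  by rewrite !hornerE ?subr0 ?mulr1 mulrC.
apply: eq_circle_approx (circle_approxM (circle_approx_poly _) (circle_approx_geometric bV1)).
move=> u _; rewrite !hornerE.
have -> : b - u = b * (1 - b^-1 * u) by rewrite mulrBr mulr1 mulVKf.
by rewrite invfM; ring.
Qed.

Lemma circle_approx_inside (a b : R[i]) : normc b < 1 ->
  circle_approx (fun u => conjc ((a - u) / (b - u))) 1.
Proof.
move=> b1; have cb1 : normc (conjc b) < 1 by rewrite normc_conj.
have -> : 1 = (1 - (conjc a) *: 'X).[0] * 1 :> R[i] by rewrite !hornerE ?mulr0 ?subr0.
apply: eq_circle_approx (circle_approxM (circle_approx_poly _) (circle_approx_geometric cb1)).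
move=> u u1; have uu := mulc_conj_norm1 u1; rewrite !hornerE.
have u0 : u != 0.
  by apply/eqP => u0; move/eqP: u1; rewrite u0 normc0 eq_sym oner_eq0.
rewrite rmorphM fmorphV !rmorphB /=.
(* Applied to numerator and denominator, this produces the same factor u in both, which cancels. *)
have E (x : R[i]) : 1 - x * u = u * (conjc u - x) by rewrite mulrBr uu mulrC.
by rewrite !E invfM mulrACA divff// mul1r -[RHS]mulrNN -invrN !opprB.
Qed.

(** Telescoping: the factors are replaced one at a time, each replacement costing at most [d] times
    a power of [K], rounded up to the full power since [K] is at least 1. *)
Lemma normc_prod_sub_le (P G : R[i] -> R[i]) (K d : R) (us : seq R[i]) : 1 <= K ->
  (forall u, u \in us ->
     [/\ normc (P u) <= K, normc (G u) <= K & normc (P u - G u) <= d]) ->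
  normc (\prod_(u <- us) P u - \prod_(u <- us) G u) <= (size us)%:R * K ^+ size us * d.
Proof.
move=> K1; have K0 : 0 <= K by exact: le_trans K1.
have prodK vs : (forall u, u \in vs -> normc (G u) <= K) ->
    normc (\prod_(u <- vs) G u) <= K ^+ size vs.
  elim: vs => [|v vs IHvs] vsK; first by rewrite big_nil normc1.
  rewrite big_cons normcM exprS ler_pM ?normc_ge0 ?vsK ?mem_head// IHvs// => u uvs.
  by rewrite vsK// inE uvs orbT.
elim: us => [|v vs IHvs] H; first by rewrite !big_nil subrr normc0 !mul0r.
have [PK GK PG] := H v (mem_head _ _).
have {}H u : u \in vs -> [/\ normc (P u) <= K, normc (G u) <= K & normc (P u - G u) <= d].
  by move=> uvs; apply: H; rewrite inE uvs orbT.
have d0 : 0 <= d by exact: le_trans (normc_ge0 _) PG.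
rewrite !big_cons /=.
set p := \prod_(j <- vs) P j; set g := \prod_(j <- vs) G j.
have -> : P v * p - G v * g = P v * (p - g) + (P v - G v) * g by ring.
apply: le_trans (normc_le_add _ _) _; rewrite !normcM.
apply: (@le_trans _ _ (K * ((size vs)%:R * K ^+ size vs * d) + d * K ^+ size vs)).
  apply: lerD; apply: ler_pM; rewrite ?normc_ge0 ?IHvs//.
  by apply: prodK => u /H[].
rewrite -natr1 exprS.
have : d * K ^+ size vs <= d * (K * K ^+ size vs).
  by rewrite ler_wpM2l// ler_peMl// exprn_ge0.
by lra.
Qed.

Lemma circle_approx_prod_list G c n : circle_approx G c ->
  forall e, 0 < e -> exists2 P : {poly R[i]}, P.[0] = c &
    forall us, size us = n -> (forall u, u \in us -> normc u = 1) ->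
      normc (\prod_(u <- us) G u - \prod_(u <- us) P.[u]) <= e.
Proof.
move=> aG e e0; have [C C0 GC] := circle_approx_bounded aG.
pose K := C + 1; have K1 : 1 <= K by rewrite lerDr.
(* The added 1 keeps the divisor positive when [n] is 0. *)
pose L := n%:R * K ^+ n + 1.
have L0 : 0 < L by rewrite ltr_wpDl// mulr_ge0// exprn_ge0// (le_trans _ K1).
pose d := Num.min 1 (e / L).
have d0 : 0 < d by rewrite lt_min ltr01 divr_gt0.
have d1 : d <= 1 by rewrite ge_min lexx.
have de : L * d <= e by rewrite mulrC -ler_pdivlMr// ge_min lexx orbT.
have [P P0 PG] := aG d d0; exists P => // us un us1.
rewrite -normc_opp opprB; apply: le_trans de.
apply: le_trans (normc_prod_sub_le (d := d) K1 _) _ => [u uus|].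
  have u1 := us1 u uus; split; [|by rewrite (le_trans (GC u u1))// lerDl|exact: PG].
  rewrite -[P.[u]](subrK (G u)) addrC; apply: le_trans (normc_le_add _ _) _.
  by rewrite lerD ?GC// (le_trans (PG u u1)).
by rewrite un /L mulrDl lerDl mul1r ltW.
Qed.

Lemma map_eit_norm1 (s : seq R) u : u \in map (@eit R) s -> normc u = 1.
Proof. by case/mapP => x _ ->; exact: normc_eit. Qed.

Lemma cbe_regular_approx n G c : circle_approx G c ->
  cbe_regular n (fun us => \prod_(u <- us) G u).
Proof.
move=> aG; apply: cbuc_lim => e /(circle_approx_prod_list n aG)[P _ PG].
exists (fun s => \prod_(u <- map (@eit R) s) P.[u]); first exact: cbe_regular_poly.
by move=> s sn; apply: PG; [rewrite size_map|exact: map_eit_norm1].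
Qed.

(** The polynomial approximants all have the integral on the right, and the density is bounded, so
    the weighted integrands converge uniformly. *)
Lemma cbe_int_approx (beta : R) n G c : 0 < beta -> circle_approx G c ->
  cbe_int beta n (fun us => \prod_(u <- us) G u) = c ^+ n * cbe_int beta n (fun=> 1).
Proof.
move=> beta0 aG; apply: ctint_lim => e e0.
have [[D wD] _] := buc_cbe_density beta0 n.
have D0 : 0 < `|D| + 1 by rewrite ltr_wpDl.
have [|P P0 PG] := circle_approx_prod_list n aG (e := e / (`|D| + 1)).
  by rewrite divr_gt0.
exists (fun s => \prod_(u <- map (@eit R) s) P.[u] * (weight beta (map (@eit R) s))%:C%C).
split.
- exact: (cbuc_cbe beta0 (cbe_regular_poly n P)).
- by rewrite -P0 -cbe_int_poly.
- move=> s sn; rewrite -mulrBl normcM normc_real -[leRHS](divfK (lt0r_neq0 D0)).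
  apply: ler_pM; rewrite ?normc_ge0//.
    by apply: PG; [rewrite size_map|exact: map_eit_norm1].
  rewrite -cbe_density_weight (le_trans (wD s sn))//.
  by rewrite (le_trans (ler_norm _))// lerDl.
Qed.

End CircleApprox.

(** * The expectation *)

Section ComplexExponential.
Context (R : realType).
Implicit Types x y z w : R[i].

Lemma cexpD x y : cexp (x + y) = cexp x * cexp y.
Proof.
case: x y => [a b] [c d]; rewrite /cexp /= expRD rmorphM /= -!/(eit _) eitD; ring.
Qed.

Lemma cexp0 : cexp 0 = 1 :> R[i].
Proof. by rewrite /cexp /= expR0 -/(eit 0) eit0 mulr1. Qed.

Lemma cexp_neq0 x : cexp x != 0.
Proof.
apply/eqP => x0; have /eqP := cexpD x (- x).
by rewrite subrr cexp0 x0 mul0r oner_eq0.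
Qed.

Lemma cexpN x : cexp (- x) = (cexp x)^-1.
Proof. by apply: (mulIf (cexp_neq0 x)); rewrite -cexpD addNr cexp0 mulVf ?cexp_neq0. Qed.

Lemma cexpMn x n : cexp (x *+ n) = cexp x ^+ n.
Proof. by elim: n => [|n IHn]; rewrite ?mulr0n ?cexp0// mulrS cexpD IHn exprS. Qed.

Lemma cexp_sum (I : Type) (r : seq I) (f : I -> R[i]) :
  cexp (\sum_(i <- r) f i) = \prod_(i <- r) cexp (f i).
Proof. by apply: (big_morph _ cexpD cexp0). Qed.

Lemma normc_cexp x : normc (cexp x) = expR (complex.Re x).
Proof. by rewrite /cexp normcM normc_real -/(eit _) normc_eit mulr1 ger0_norm ?expR_ge0. Qed.

(** The sign of Im w thus decides on which side of the unit circle the pole lies. *)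
Lemma normc_cexp_idiv w n : normc (cexp ('i%C * w / n%:R)) = expR (- complex.Im w / n%:R).
Proof.
rewrite normc_cexp -(rmorph_nat (real_complex R)) -fmorphV.
by case: w => a b /=; congr expR; ring.
Qed.

End ComplexExponential.

Section RatioOfCharacteristicPolynomials.
Context (R : realType) (beta : R) (n l : nat).
Hypothesis beta_gt0 : 0 < beta.

Lemma cbe_int1 : cbe_int beta n (fun=> 1) = (tint n (@cbe_density R beta))%:C%C.
Proof.
rewrite -ctint_real; apply: eq_ctint => s _.
by rewrite mul1r cbe_density_weight.
Qed.

(** The factorization of [F] is asked only when no point equals 1, where the normalization of the
    characteristic polynomial would divide by zero. The excluded angles lie on the faces of the
    cube. *)
Lemma cbe_E_prod (F : seq R[i] -> R[i]) (G : R[i] -> R[i]) (K c : R[i]) :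
  cbe_regular n (fun us => \prod_(u <- us) G u) ->
  cbe_int beta n (fun us => \prod_(u <- us) G u) = c ^+ n * cbe_int beta n (fun=> 1) ->
  (forall us, all (fun u => (normc u == 1) && (u != 1)) us ->
     F us = K * \prod_(u <- us) G u) ->
  cbe_E n beta F = K * c ^+ n.
Proof.
move=> rG intG FG; have T0 : (tint n (@cbe_density R beta))%:C%C != 0 :> R[i].
  by rewrite (inj_eq (@complexI R)) gt_eqF// tint_cbe_density_gt0.
apply: (mulIf T0); rewrite /cbe_E divfK// -cbe_int1 -mulrA -intG -cbe_intZ//.
have rKG : cbe_regular n (fun us => K * \prod_(u <- us) G u).
  by apply: cbucM => //; exact: cbuc_cst.
apply: eq_ctint_interior (cbuc_cbe beta_gt0 rKG) => s sn s02.
rewrite cbe_density_weight FG// all_map; apply: sub_all s02 => x x02 /=.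
by rewrite eit_neq1// andbT; apply/eqP; exact: normc_eit.
Qed.

Lemma pn_ratio (us : seq R[i]) (Z W a b : R[i]) : all (fun u => u != 1) us ->
  (pn us Z * a) / (pn us W * b) = a / b * \prod_(u <- us) ((Z - u) / (W - u)).
Proof.
move=> us1; have D0 : \prod_(u <- us) (1 - u) != 0.
  by rewrite prodf_seq_neq0; apply: sub_all us1 => u; rewrite subr_eq0 eq_sym.
rewrite /pn !prodf_div !invfM invrK.
set A := \prod_(u <- us) (Z - u); set B := \prod_(u <- us) (W - u).
set D := \prod_(u <- us) (1 - u).
(* Multiplying and dividing the right side by the nonzero [D] leaves an identity in which inverses
   are mere atoms. *)
by rewrite -[RHS](mulfK D0) -/D; ring.
Qed.

Variables (z w : 'I_l -> R[i]).
Let Z j := cexp ('i%C * z j / n%:R).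
Let W j := cexp ('i%C * w j / n%:R).
Let ratio u := \prod_(j < l) ((Z j - u) / (W j - u)).
Let phase := \prod_(j < l) (cexp (- 'i%C * z j / 2) / cexp (- 'i%C * w j / 2)).

(** Exchanging the products over j and over the points gives a single function evaluated at each
    point, times a factor independent of the ensemble. *)
Lemma cbe_E_ratio (c : R[i]) :
  cbe_regular n (fun us => \prod_(u <- us) ratio u) ->
  cbe_int beta n (fun us => \prod_(u <- us) ratio u) = c ^+ n * cbe_int beta n (fun=> 1) ->
  cbe_E n beta (fun zs =>
      \prod_(j < l)
        ((pn zs (cexp ('i%C * z j / n%:R)) * cexp (- 'i%C * z j / 2))
         / (pn zs (cexp ('i%C * w j / n%:R)) * cexp (- 'i%C * w j / 2)))) =
  phase * c ^+ n.
Proof.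
move=> rG intG; apply: cbe_E_prod rG intG _ => us us1.
rewrite /ratio exchange_big -big_split; apply: eq_bigr => j _ /=.
by rewrite pn_ratio//; apply: sub_all us1 => u /andP[].
Qed.

Lemma ratio_outside : (forall j, complex.Im (w j) < 0) -> (0 < n)%N ->
  circle_approx ratio (\prod_(j < l) (Z j / W j)).
Proof.
move=> w0 n0; apply: circle_approx_prod => j; apply: circle_approx_outside.
by rewrite normc_cexp_idiv expR_gt1 divr_gt0 ?ltr0n// oppr_gt0.
Qed.

Lemma ratio_inside : (forall j, 0 < complex.Im (w j)) -> (0 < n)%N ->
  circle_approx (fun u => conjc (ratio u)) 1.
Proof.
move=> w0 n0; have -> : 1 = \prod_(j < l) 1 :> R[i] by rewrite big1.
apply: (eq_circle_approx (G := fun u => \prod_(j < l) conjc ((Z j - u) / (W j - u)))).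
  by move=> u _; rewrite rmorph_prod.
apply: circle_approx_prod => j; apply: circle_approx_inside.
by rewrite normc_cexp_idiv expR_lt1 mulNr oppr_lt0 divr_gt0 ?ltr0n.
Qed.

Lemma phase_inside : phase = cexp (- 'i%C * \sum_(j < l) ((z j - w j) / 2)).
Proof.
rewrite mulr_sumr cexp_sum; apply: eq_bigr => j _.
by rewrite -cexpN -cexpD; congr cexp; ring.
Qed.

(** The n-th power removes the 1/n from the exponents, giving e^(i(z_j - w_j)) for each j; the phase
    takes half of that exponent back. *)
Lemma phase_outside : (0 < n)%N ->
  phase * (\prod_(j < l) (Z j / W j)) ^+ n =
  cexp ('i%C * \sum_(j < l) ((z j - w j) / 2)).
Proof.
move=> n0; rewrite -prodrXl -big_split mulr_sumr cexp_sum; apply: eq_bigr => j _ /=.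
have nn0 : n%:R != 0 :> R[i] by rewrite pnatr_eq0 -lt0n.
have powE x : cexp ('i%C * x / n%:R) ^+ n = cexp ('i%C * x) :> R[i].
  by rewrite -cexpMn -[X in cexp X]mulr_natr divfK.
rewrite expr_div_n /Z /W !powE -!cexpN -!cexpD; congr cexp.
by move: 'i%C (z j) (w j) => i a b; field.
Qed.

End RatioOfCharacteristicPolynomials.

Theorem theorem7p9 (R : realType) (beta : R) (n l : nat)
    (z w : 'I_l -> R[i]) :
  0 < beta -> (1 <= n)%N -> (1 <= l)%N ->
  (forall j, complex.Im (w j) != 0) ->
  let LHS := cbe_E n beta (fun zs =>
      \prod_(j < l)
        ((pn zs (cexp ('i%C * z j / n%:R)) * cexp (- 'i%C * z j / 2))
         / (pn zs (cexp ('i%C * w j / n%:R)) * cexp (- 'i%C * w j / 2)))) in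
  ((forall j, complex.Im (w j) < 0) ->
     LHS = cexp ('i%C * \sum_(j < l) ((z j - w j) / 2))) /\
  ((forall j, 0 < complex.Im (w j)) ->
     LHS = cexp (- 'i%C * \sum_(j < l) ((z j - w j) / 2))).
Proof.
move=> beta0 n0 _ _ LHS; split=> w0.
  have aG := ratio_outside z w0 n0.
  rewrite -(phase_outside z w n0); apply: cbe_E_ratio => //.
    exact: cbe_regular_approx aG.
  exact: cbe_int_approx.
have aG := ratio_inside z w0 n0.
(* The right side is written as the phase times 1^n, to match [cbe_E_ratio] with constant 1. *)
rewrite -phase_inside -[RHS]mulr1 -[X in _ = _ * X](expr1n _ n).
pose G u := \prod_(j < l) ((cexp ('i%C * z j / n%:R) - u) / (cexp ('i%C * w j / n%:R) - u)).
have conjG us : \prod_(u <- us) G u = conjc (\prod_(u <- us) conjc (G u)).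
  by rewrite rmorph_prod; apply: eq_bigr => u _; exact/esym/conjcK.
have rG := cbe_regular_approx n aG.
apply: cbe_E_ratio => //.
  by apply: eq_cbuc (cbuc_conj rG) => s _; rewrite -conjG.
have intG := cbe_int_approx n beta0 aG; rewrite expr1n mul1r in intG *.
(* The approximation concerns the conjugate of [G], so its integral is conjugated back; the
   partition function is real. *)
transitivity (conjc (cbe_int beta n (fun=> 1))); last by rewrite cbe_int1 conjc_real.
rewrite -intG -[RHS](ctint_conj (cbuc_cbe beta0 rG)).
by apply: eq_ctint => s _; rewrite [RHS]rmorphM conjG;
  congr (_ * _); exact/esym/conjc_real.
Qed.
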